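(* Let $\alpha\in A$ be such that $A\setminus\{\alpha\}$ has rank $1+n$, and let $\beta_\alpha$ be the row of the Gale dual $B$ of $A$ corresponding to $\alpha$. If the cuspidal form $P_{A\setminus\{\alpha\}}$ is trivial (identically zero), then $\langle\beta_\alpha,t\rangle$ divides $P_A(t)$.
   Context: Setting. Let $n\ge1$. A point configuration is a real $(1+n)\times N$ matrix $A$ (identified with the family of its columns, which need not be distinct) of rank $1+n$ with top row the all ones vector; $m=N-n-1$, and here $m\geq 1$ for $A$. Let $\hat A$ be the $n\times N$ matrix obtained by deleting the top row. A Gale dual of $A$ is an $N\times m$ matrix $B$ of rank $m$ with $AB=0$, with rows $\beta_1,\dots,\beta_N$ indexed by the columns of $A$; write $\langle\beta,t\rangle=\sum_i\beta_it_i$ for $t\in\mathbb{C}^m$. The cuspidal form of $A$ (with respect to $B$) is $$P_A(t)=\sum_{\sigma}|\hat A_\sigma|^2\prod_{k\in\sigma}\langle\beta_k,t\rangle ,$$ the sum over all $n$-element subsets $\sigma\subset\{1,\dots,N\}$, where $|\hat A_\sigma|$ is the determinant of the $n\times n$ submatrix of $\hat A$ with columns in $\sigma$. (If $m=0$, then $P_A=0$.) Whether $P_A$ is identically zero does not depend on the choice of Gale dual. $A\setminus\{\alpha\}$ denotes the configuration obtained by deleting the column $\alpha$. Divisibility is in the polynomial ring $\mathbb{C}[t_1,\dots,t_m]$. *)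

(* Defs.v *)
From HB Require Import structures.
From mathcomp Require Import all_boot all_order all_algebra.
From mathcomp Require Import reals.
From mathcomp Require Import complex.
From mathcomp Require Import mpoly.

Set Implicit Arguments.
Unset Strict Implicit.
Unset Printing Implicit Defensive.

Import GRing.Theory.
Local Open Scope ring_scope.
Local Open Scope complex_scope.

Definition point_configuration (R : realType) (n N : nat)
    (A : 'M[R]_(1 + n, N)) : Prop :=
  usubmx A = const_mx 1 /\ \rank A = (1 + n)%N.

(* The subtraction is truncated, but for a point configuration the rank
   condition forces n + 1 <= N.  The entries of B may be complex; real Gale
   duals are a special case. *)
Definition gale_dual (R : realType) (n N : nat) (A : 'M[R]_(1 + n, N))
    (B : 'M[R[i]]_(N, N - n - 1)) : Prop :=
  map_mx (real_complex R) A *m B = 0 /\ \rank B = (N - n - 1)%N.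

Definition linear_form (K : comNzRingType) (N m : nat) (B : 'M[K]_(N, m))
    (k : 'I_N) : {mpoly K[m]} :=
  \sum_(i < m) B k i *: 'X_i.

(* The columns of M in s are taken in increasing order of index.  The matrix
   in [conform_mx] is the square matrix [colsub enum_val M] when #|s| = n,
   the only case in which it is used. *)
Definition maximal_minor (K : comNzRingType) (n N : nat) (M : 'M[K]_(n, N))
    (s : {set 'I_N}) : K :=
  \det (conform_mx (0 : 'M[K]_n) (colsub (@enum_val _ (mem s)) M)).

(* [dsubmx A] is A without its top row.  When N - n - 1 = 0 and 0 < n, all
   linear forms are empty sums, so that the cuspidal form is 0. *)
Definition cuspidal_form (R : realType) (n N : nat) (A : 'M[R]_(1 + n, N))
    (B : 'M[R[i]]_(N, N - n - 1)) : {mpoly R[i][N - n - 1]} :=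
  \sum_(s : {set 'I_N} | #|s| == n)
    ((maximal_minor (dsubmx A) s) ^+ 2)%:C *: \prod_(k in s) linear_form B k.

Definition mpoly_divides (K : comNzRingType) (m : nat) (p q : {mpoly K[m]}) :
    Prop :=
  exists r : {mpoly K[m]}, q = r * p.

(* Main.v *)
Require Import Defs.
From mathcomp Require Import all_boot all_order all_algebra.
From mathcomp Require Import reals.
From mathcomp Require Import complex.
From mathcomp Require Import mpoly.

(* Subtracting from B the matrix B v beta_alpha, where v is chosen so that the
   row alpha of the result C vanishes, changes every linear form by a multiple
   of <beta_alpha, t>.  The remaining rows of C have columns in the kernel of
   A \ {alpha}, hence equal B' S for some S: modulo <beta_alpha, t>, the form
   P_A is the image of P_(A \ {alpha}) under the linear substitution S. *)

Import GRing.Theory.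
Local Open Scope ring_scope.
Local Open Scope complex_scope.

Section CongruenceModulo.

Context {K : comNzRingType} {m : nat} (p : {mpoly K[m]}).

Lemma mpoly_divides_refl_sub (a : {mpoly K[m]}) : mpoly_divides p (a - a).
Proof. by exists 0; rewrite subrr mul0r. Qed.

Lemma mpoly_divides_subD (a b c d : {mpoly K[m]}) :
  mpoly_divides p (a - b) -> mpoly_divides p (c - d) ->
  mpoly_divides p ((a + c) - (b + d)).
Proof.
move=> [r Er] [q Eq]; exists (r + q).
by rewrite mulrDl -Er -Eq opprD addrACA.
Qed.

Lemma mpoly_divides_subM (a b c d : {mpoly K[m]}) :
  mpoly_divides p (a - b) -> mpoly_divides p (c - d) ->
  mpoly_divides p (a * c - b * d).
Proof.
(* The witness comes from a c - b d = (a - b) c + b (c - d). *)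
move=> [r Er] [q Eq]; exists (r * c + b * q).
by rewrite mulrDl mulrAC -Er -mulrA -Eq mulrBl mulrBr addrA subrK.
Qed.

Lemma mpoly_divides_subZ (c : K) (a b : {mpoly K[m]}) :
  mpoly_divides p (a - b) -> mpoly_divides p (c *: a - c *: b).
Proof. by move=> [r Er]; exists (c *: r); rewrite -scalerBr Er scalerAl. Qed.

End CongruenceModulo.

Lemma linear_form_sub (K : comNzRingType) (N m : nat) (B C : 'M[K]_(N, m))
    (k : 'I_N) :
  linear_form (B - C) k = linear_form B k - linear_form C k.
Proof.
rewrite /linear_form -sumrB; apply: eq_bigr => i _.
by rewrite !mxE scalerBl.
Qed.

Lemma linear_form_mulmx (K : comNzRingType) (N m p : nat) (B : 'M[K]_(N, p))
    (S : 'M[K]_(p, m)) (k : 'I_N) :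
  linear_form (B *m S) k = \sum_(j < p) B k j *: linear_form S j.
Proof.
rewrite /linear_form.
under eq_bigr do rewrite mxE scaler_suml.
rewrite exchange_big; apply: eq_bigr => j _.
by rewrite scaler_sumr; apply: eq_bigr => i _; rewrite scalerA.
Qed.

Lemma linear_form_mulmx_comp (K : comNzRingType) (N m p : nat)
    (B : 'M[K]_(N, p)) (S : 'M[K]_(p, m)) (k : 'I_N) :
  linear_form (B *m S) k =
  linear_form B k \mPo [tuple linear_form S j | j < p].
Proof.
rewrite linear_form_mulmx /linear_form raddf_sum; apply: eq_bigr => j _ /=.
by rewrite comp_mpolyZ comp_mpolyXU -tnth_nth tnth_mktuple.
Qed.

(** A finite set has only one strictly increasing listing, so [f] and [enum_val] run through [s] in
    the same order and no sign appears. *)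
Lemma maximal_minor_monotone (K : comNzRingType) (n N : nat) (M : 'M[K]_(n, N))
    (s : {set 'I_N}) (f : 'I_n -> 'I_N) :
  {homo f : i j / (i < j)%N} -> s = [set f i | i : 'I_n] ->
  maximal_minor M s = \det (colsub f M).
Proof.
move=> f_mono s_def.
have f_inj : injective f.
  move=> i j eq_f; apply: val_inj.
  by case: (ltngtP i j) => // /f_mono; rewrite eq_f ltnn.
have card_s : #|s| = n by rewrite s_def card_imset // card_ord.
have enum_s : enum (mem s) = [seq f i | i <- enum 'I_n].
  apply: (inj_map val_inj); apply: (irr_sorted_eq ltn_trans ltnn).
  - apply: (subseq_sorted ltn_trans _ (iota_ltn_sorted 0 N)).
    by rewrite -val_enum_ord map_subseq // enumT filter_subseq.
  - rewrite -map_comp; apply: (@homo_sorted _ _ _ (relpre val ltn)) => //.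
    by rewrite -sorted_map val_enum_ord iota_ltn_sorted.
  - apply: eq_mem_map => k; rewrite mem_enum s_def.
    apply/imsetP/mapP => -[i _ ->]; exists i => //.
    by rewrite mem_enum.
(* Once [n] is literally [#|s|], the cast [conform_mx] reduces by [conform_mx_id]. *)
subst n.
rewrite /maximal_minor conform_mx_id; congr (\det _).
apply/matrixP => i j; rewrite !mxE; congr (M i _).
rewrite (enum_val_nth (f j)) enum_s (nth_map j) ?size_enum_ord //.
by rewrite nth_ord_enum.
Qed.

(** Since [lift alpha] is increasing, its composite with the enumeration of [s] is the increasing
    listing of the image. *)
Lemma maximal_minor_lift (K : comNzRingType) (n N : nat) (M : 'M[K]_(n, N))
    (alpha : 'I_N) (s : {set 'I_N.-1}) :
  #|s| = n ->
  maximal_minor M (lift alpha @: s) = maximal_minor (col' alpha M) s.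
Proof.
move=> card_s; subst n.
have val_mono : {homo (@enum_val _ (mem s)) : i j / (i < j)%N}.
  move=> i j lt_ij; have x0 := enum_val i.
  have: sorted ltn [seq val k | k <- enum (mem s)].
    apply: (subseq_sorted ltn_trans _ (iota_ltn_sorted 0 N.-1)).
    by rewrite -val_enum_ord map_subseq // enumT filter_subseq.
  move/(sorted_ltn_nth ltn_trans 0%N)/(_ i j).
  rewrite !inE size_map -cardE !ltn_ord => /(_ isT isT lt_ij).
  by rewrite !(nth_map x0) -?cardE // -!enum_val_nth.
have s_def : s = [set enum_val i | i : 'I_#|s|].
  apply/setP => k; apply/idP/imsetP => [ks|[i _ ->]]; last exact: enum_valP.
  by exists (enum_rank_in ks k); rewrite // enum_rankK_in.
rewrite (maximal_minor_monotone _ _ _ (col' alpha M) s enum_val) //.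
rewrite (maximal_minor_monotone _ _ _ M _ (lift alpha \o @enum_val _ (mem s))).
- by congr (\det _); apply/matrixP => i j; rewrite !mxE.
- by move=> i j /val_mono; rewrite /= !ltnNge leq_bump2.
- by rewrite [in LHS]s_def -imset_comp.
Qed.

(** By the rank condition, the columns of [B] span the whole kernel of [A]. Transposes turn column
    spaces into the row spaces that [submx] compares. *)
Lemma gale_dual_factor (F : fieldType) (p N m q : nat) (A : 'M[F]_(p, N))
    (B : 'M[F]_(N, m)) (D : 'M[F]_(N, q)) :
  A *m B = 0 -> (\rank A + \rank B)%N = N -> A *m D = 0 ->
  exists S : 'M[F]_(m, q), D = B *m S.
Proof.
move=> AB0 rankAB AD0.
have kerP (r : nat) (E : 'M[F]_(N, r)) :
    A *m E = 0 -> (E^T <= kermx A^T)%MS.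
  by move=> AE0; apply/sub_kermxP; rewrite -trmx_mul AE0 trmx0.
have: (D^T <= B^T)%MS.
  apply: submx_trans (kerP _ _ AD0) _.
  (* The row space of [B^T] lies in the kernel; equality follows from the dimension N - rank A =
     rank B. *)
  rewrite -(geq_leqif (mxrank_leqif_sup (kerP _ _ AB0))).
  by rewrite mxrank_ker !mxrank_tr leq_subLR rankAB.
by case/submxP=> S /(congr1 trmx); rewrite trmxK trmx_mul trmxK; exists S^T.
Qed.

Lemma mulmx_col'_row' (K : comNzRingType) (p N q : nat) (A : 'M[K]_(p, N))
    (C : 'M[K]_(N, q)) (alpha : 'I_N) :
  row alpha C = 0 -> col' alpha A *m row' alpha C = A *m C.
Proof.
move=> /rowP C0; apply/matrixP => i j; rewrite !mxE.
rewrite [RHS](bigD1_ord alpha) //=.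
have := C0 j; rewrite !mxE => ->; rewrite mulr0 add0r.
by apply: eq_bigr => k _; rewrite !mxE.
Qed.

(** Only sets avoiding [alpha] contribute, and on these, preimage under [lift alpha] inverts
    image. *)
Lemma sum_sets_lift (V : zmodType) (n N : nat) (alpha : 'I_N)
    (F : {set 'I_N} -> V) :
  (forall s : {set 'I_N}, alpha \in s -> F s = 0) ->
  \sum_(s : {set 'I_N} | #|s| == n) F s =
  \sum_(s : {set 'I_N.-1} | #|s| == n) F (lift alpha @: s).
Proof.
move=> F0; rewrite (bigID (fun s : {set _} => alpha \in s)) /=.
rewrite big1 ?add0r; last by move=> s /andP[_ /F0].
rewrite (reindex_onto (fun s : {set 'I_N.-1} => lift alpha @: s)
           (fun s => lift alpha @^-1: s)) /=; last first.
  move=> s /andP[_ alpha_s]; apply/setP => k; apply/imsetP/idP.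
    by case=> j; rewrite inE => ? ->.
  move=> ks; case: (unliftP alpha k) => [j|] E; last by rewrite -E ks in alpha_s.
  by exists j; rewrite // inE -E.
apply: eq_bigl => s; rewrite card_imset; last exact: lift_inj.
have -> : alpha \in lift alpha @: s = false.
  by apply/imsetP => -[j _ /eqP]; rewrite (negPf (neq_lift _ _)).
have -> : lift alpha @^-1: (lift alpha @: s) == s.
  by apply/eqP/setP => j; rewrite inE mem_imset //; apply: lift_inj.
by rewrite !andbT.
Qed.

Theorem corollary5p1 (R : realType) (n N : nat) (hn : (1 <= n)%N)
    (A : 'M[R]_(1 + n, N)) (hA : point_configuration A)
    (hm : (1 <= N - n - 1)%N)
    (B : 'M[R[i]]_(N, N - n - 1)) (hB : gale_dual A B)
    (alpha : 'I_N)
    (hdel : \rank (col' alpha A) = (1 + n)%N)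
    (B' : 'M[R[i]]_(N.-1, N.-1 - n - 1)) (hB' : gale_dual (col' alpha A) B')
    (htriv : cuspidal_form (col' alpha A) B' = 0) :
  mpoly_divides (linear_form B alpha) (cuspidal_form A B).
Proof.
have [AB0 _] := hB; have [AB'0 rankB'] := hB'.
set b := row alpha B.
(* The vector v is [B *m pinvmx b]. As b b^+ b = b for the pseudo-inverse b^+, row [alpha] of [D] is
   [b], with no case distinction on b = 0. *)
pose D := B *m pinvmx b *m b.
pose C := B - D.
have linD k : mpoly_divides (linear_form B alpha) (linear_form D k).
  (* Row k of [D] is v_k times [b], so the quotient is the constant v_k. *)
  exists ((B *m pinvmx b) k 0)%:MP.
  rewrite linear_form_mulmx big_ord1 mul_mpolyC; congr (_ *: _).
  by apply: eq_bigr => i _; rewrite mxE.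
have linBC k :
    mpoly_divides (linear_form B alpha) (linear_form B k - linear_form C k).
  by rewrite linear_form_sub opprB addrCA subrr addr0.
have rowC : row alpha C = 0.
  by rewrite /C /D linearB /= !row_mul -/b mulmxKpV ?subrr.
have AC0 : map_mx (real_complex R) A *m C = 0.
  by rewrite mulmxBr /D !mulmxA AB0 !mul0mx subrr.
have [S C'E] : exists S, row' alpha C = B' *m S.
  apply: gale_dual_factor AB'0 _ _.
    (* The truncated subtraction is exact: [hdel] forces 1 + n <= N - 1. *)
    rewrite mxrank_map hdel rankB' -subnDA addnC (addnC n) subnK //.
    by rewrite -hdel rank_leq_col.
  by rewrite map_col' mulmx_col'_row'.
have CE k : linear_form C (lift alpha k) =
    linear_form B' k \mPo [tuple linear_form S j | j < _].
  rewrite -linear_form_mulmx_comp -C'E.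
  by apply: eq_bigr => i _; rewrite !mxE.
have Calpha : linear_form C alpha = 0.
  apply: big1 => i _; move/rowP/(_ i): rowC; rewrite !mxE => ->.
  by rewrite scale0r.
(* With [C] in place of [B], sets containing [alpha] contribute 0 by [Calpha]; the others add up to
   the image of the trivial form under the substitution [S]. *)
have PC0 : \sum_(s : {set 'I_N} | #|s| == n)
    ((maximal_minor (dsubmx A) s) ^+ 2)%:C *: \prod_(k in s) linear_form C k
    = 0.
  rewrite (sum_sets_lift _ n _ alpha); last first.
    by move=> s alpha_s; rewrite (bigD1 alpha) //= Calpha mul0r scaler0.
  rewrite -[RHS](comp_mpoly0 [tuple linear_form S j | j < _]) -htriv.
  rewrite raddf_sum; apply: eq_bigr => s /eqP card_s /=.
  rewrite comp_mpolyZ rmorph_prod maximal_minor_lift //.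
  rewrite big_imset /=; last by move=> ? ? _ _; apply: lift_inj.
  congr (((maximal_minor _ _) ^+ 2)%:C *: _).
    by apply/matrixP => i j; rewrite !mxE.
  by apply: eq_bigr => k _; rewrite CE.
(* Subtracting this zero sum leaves two sums with equal coefficients, compared term by term and
   factor by factor modulo the linear form of [alpha]. *)
rewrite -[cuspidal_form A B]subr0 -PC0 /cuspidal_form.
apply: (big_ind2 (fun a c => mpoly_divides _ (a - c))).
- exact: mpoly_divides_refl_sub.
- by move=> *; apply: mpoly_divides_subD.
move=> s _; apply: mpoly_divides_subZ.
apply: (big_ind2 (fun a c => mpoly_divides _ (a - c))) => //.
- exact: mpoly_divides_refl_sub.
- by move=> *; apply: mpoly_divides_subM.
Qed.
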